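(* Let $p\in[1,+\infty]$ with conjugate exponent $q$, let $m\in\mathcal P_p(\mathbb R)$ have bounded support $\mathcal X=\mathrm{supp}(m)$. Let $R\subset\mathcal P_q(\mathbb R)$ be nonempty, bounded (i.e. $\sup_{r\in R}\mathcal M_q(r)<+\infty$), convex and closed for the weak-$^*$ topology, and assume that the set $\mathcal Y_R=\bigcup_{r\in R}\mathrm{supp}(r)\subset\mathbb R$ is bounded. Then both problems $$\inf_{(f,g)\in K}\mathcal J(f,g)\qquad\text{and}\qquad\inf_{g\in\mathcal C_q^0(\mathcal Y_R)}\tilde{\mathcal J}(g)$$ have a solution (i.e. both infima are attained).
   Context: The conjugate exponent $q$ of $p$ satisfies $1/p+1/q=1$ ($q=+\infty$ if $p=1$, $q=1$ if $p=+\infty$). For a Borel probability measure $m$ on $\mathbb R$, $\mathcal M_s(m)=\big(\int|x|^s\,\mathrm dm(x)\big)^{1/s}$ if $s<+\infty$ and $\mathcal M_\infty(m)=\sup_{x\in\mathrm{supp}(m)}|x|$; $\mathcal P_s(\mathbb R)$ is the set of Borel probability measures on $\mathbb R$ with $\mathcal M_s(m)<+\infty$. For $\mathcal Z\subset\mathbb R$, $\mathcal C_s^0(\mathcal Z)$ is the space of continuous $f:\mathcal Z\to\mathbb R$ with $\|f\|_s=\sup_{x\in\mathcal Z}\frac{|f(x)|}{1+|x|^s}<+\infty$ if $s<+\infty$, and the space of bounded continuous functions with the supremum norm if $s=+\infty$. Elements of $\mathcal P_q(\mathbb R)$ are seen as elements of the topological dual $\mathcal C_q^0(\mathbb R)^*$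 through $\langle r,g\rangle=\int g\,\mathrm dr$, and ''closed for the weak-$^*$ topology'' means weakly-$^*$ closed in $\mathcal C_q^0(\mathbb R)^*$. For $g\in\mathcal C_q^0(\mathcal Y_R)$: $\sigma_R(g)=\sup_{r\in R}\int_{\mathcal Y_R}g\,\mathrm dr$, and $g^*(x)=\sup_{y\in\mathcal Y_R}\{xy-g(y)\}$ for $x\in\mathcal X$. The set $K$ consists of all $(f,g)\in\mathcal C_p^0(\mathcal X)\times\mathcal C_q^0(\mathcal Y_R)$ such that $xy\le f(x)+g(y)$ for all $(x,y)\in\mathcal X\times\mathcal Y_R$. Finally, $$\mathcal J(f,g)=\int_{\mathcal X}f\,\mathrm dm+\sigma_R(g),\qquad\tilde{\mathcal J}(g)=\int_{\mathcal X}g^*\,\mathrm dm+\sigma_R(g).$$ *)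

(* Defs.v *)
From HB Require Import structures.
From mathcomp Require Import all_boot all_order all_algebra.
From mathcomp Require Import all_classical all_reals all_analysis.
Import Order.TTheory GRing.Theory Num.Theory.
Import numFieldNormedType.Exports.

Set Implicit Arguments.
Unset Strict Implicit.
Unset Printing Implicit Defensive.

Local Open Scope classical_set_scope.
Local Open Scope ring_scope.

(* An extended real [s] below stands for an exponent in [1, +oo]; the case -oo,
   which never occurs, is treated as +oo. *)

Section measures.
Context {R : realType}.
Notation prob := (probability (measurableTypeR R) R).
Implicit Types (m : prob) (s : \bar R).

Definition supp m : set R :=
  [set x : R | forall U : set R, open_nbhs x U -> (0 < m U)%E].

Definition moment s m : \bar R :=
  if s is s'%:E then ((\int[m]_x (`|x : R| `^ s')%:E) `^ s'^-1)%E
  else ereal_sup [set (`|x|)%:E | x in supp m].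

Definition Pset s : set prob := [set m | (moment s m < +oo)%E].

(* A [probability] is a function on all sets, with unspecified values on the
   non-measurable ones; so [S] is only asked to contain a measure that agrees
   with the convex combination on measurable sets. *)
Definition convex_family (S : set prob) : Prop :=
  forall (r1 r2 : prob) (t : R), S r1 -> S r2 -> 0 <= t <= 1 ->
  exists2 r : prob, S r & forall B : set (measurableTypeR R), measurable B ->
    r B = (t%:E * r1 B + (1 - t)%:E * r2 B)%E.

End measures.

Section weighted_continuous.
Context {R : realType}.
Implicit Types (s : \bar R) (Z : set R) (f g : R -> R).

Definition weight s (x : R) : R :=
  if s is s'%:E then 1 + `|x| `^ s' else 1.

Definition wnorm s Z f : \bar R :=
  ereal_sup [set (`|f x| / weight s x)%:E | x in Z].

(* Functions on [Z] are represented by total functions, whose values outside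
   [Z] are irrelevant. *)
Definition C0 s Z : set (R -> R) :=
  [set f | {within Z, continuous f} /\ (wnorm s Z f < +oo)%E].

Lemma weight_gt0 s x : 0 < weight s x.
Proof. by case: s => [s||] //=; rewrite ltr_pwDl// powR_ge0. Qed.

Lemma wnorm_ge s f x : ((`|f x| / weight s x)%:E <= wnorm s setT f)%E.
Proof. by apply: ereal_sup_ubound; exists x. Qed.

Lemma wnorm_ge0 s f : (0 <= wnorm s setT f)%E.
Proof.
apply: le_trans (wnorm_ge s f 0).
by rewrite lee_fin divr_ge0// ltW// weight_gt0.
Qed.

Lemma wnorm_le s f (M : R) :
  (forall x, `|f x| / weight s x <= M) -> (wnorm s setT f <= M%:E)%E.
Proof. by move=> fM; apply: ge_ereal_sup => _ [x _ <-]; rewrite lee_fin. Qed.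

Lemma C0_fin_num s f : C0 s setT f -> wnorm s setT f \is a fin_num.
Proof. by case=> _ fy; rewrite ge0_fin_numE// wnorm_ge0. Qed.

Lemma fine_wnorm_ge s f x : C0 s setT f ->
  `|f x| / weight s x <= fine (wnorm s setT f).
Proof. by move=> /C0_fin_num h; rewrite -lee_fin fineK// wnorm_ge. Qed.

Lemma fine_wnorm_le s f (M : R) : C0 s setT f ->
  (forall x, `|f x| / weight s x <= M) -> fine (wnorm s setT f) <= M.
Proof. by move=> /C0_fin_num h fM; rewrite -lee_fin fineK// wnorm_le. Qed.

Definition C0_pred s : {pred R -> R^o} := mem (C0 s setT : set (R -> R)).

Lemma C0_submod_closed s : submod_closed (C0_pred s).
Proof.
split=> [|a f g].
  apply: mem_set; split; first by apply: continuous_subspaceT => x; exact: cvg_cst.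
  apply: (@le_lt_trans _ _ 0%:E); last exact: ltry.
  by apply: wnorm_le => x; rewrite normr0 mul0r.
move=> /set_mem Cf /set_mem Cg; apply: mem_set; split.
  apply: continuous_subspaceT => x.
  have fc := (continuous_subspace_setT f).2 Cf.1 x.
  have gc := (continuous_subspace_setT g).2 Cg.1 x.
  by apply: cvgD => //; exact: (@cvgZl_tmp R R^o).
pose M := `|a| * fine (wnorm s setT f) + fine (wnorm s setT g).
apply: (@le_lt_trans _ _ M%:E); last exact: ltry.
apply: wnorm_le => x.
apply: (@le_trans _ _ ((`|a| * `|f x| + `|g x|) / weight s x)).
  rewrite ler_pM2r ?invr_gt0 ?weight_gt0//.
  by rewrite (le_trans (ler_normD _ _))// normrM.
rewrite mulrDl -mulrA lerD// ?fine_wnorm_ge//.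
by rewrite ler_wpM2l// fine_wnorm_ge.
Qed.

End weighted_continuous.

Record C0R (R : realType) (s : \bar R) := MkC0R {
  C0R_fun :> R -> R^o ;
  C0RP : C0R_fun \in C0_pred s }.

Section C0R_normed.
Context {R : realType} (s : \bar R).
Implicit Types f g : C0R s.

HB.instance Definition _ := [isSub for @C0R_fun R s].
HB.instance Definition _ := [Choice of C0R s by <:].
HB.instance Definition _ := GRing.isSubmodClosed.Build _ _ (C0_pred s)
  (@C0_submod_closed R s).
HB.instance Definition _ := [SubChoice_isSubLmodule of C0R s by <:].

Definition C0R_norm f : R := fine (wnorm s setT f).

Let C0RW f : C0 s setT f. Proof. exact: set_mem (C0RP f). Qed.

Let C0R_normD f g : C0R_norm (f + g) <= C0R_norm f + C0R_norm g.
Proof.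
apply: fine_wnorm_le => // x.
apply: (@le_trans _ _ ((`|f x| + `|g x|) / weight s x)).
  by rewrite ler_pM2r ?invr_gt0 ?weight_gt0// ler_normD.
by rewrite mulrDl lerD// fine_wnorm_ge.
Qed.

Let C0R_normZ_le (a : R) f : C0R_norm (a *: f) <= `|a| * C0R_norm f.
Proof.
apply: fine_wnorm_le => // x.
rewrite [X in X / _](_ : _ = `|a| * `|f x|); last exact: normrM.
by rewrite -mulrA ler_wpM2l// /C0R_norm fine_wnorm_ge.
Qed.

Let C0R_normZ (a : R) f : C0R_norm (a *: f) = `|a| * C0R_norm f.
Proof.
have [->|a0] := eqVneq a 0.
  apply/eqP; rewrite eq_le C0R_normZ_le normr0 mul0r/=.
  by rewrite fine_ge0// wnorm_ge0.
apply/eqP; rewrite eq_le C0R_normZ_le/=.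
rewrite -ler_pdivlMl ?normr_gt0// -normfV.
by rewrite -{1}(scale1r f) -(mulVf a0) -scalerA.
Qed.

Let C0R_norm0_eq0 f : C0R_norm f = 0 -> f = 0.
Proof.
move=> f0; apply/val_inj/funext => x /=.
have := @fine_wnorm_ge _ s f x (C0RW f).
rewrite -/(C0R_norm f) f0 pmulr_lle0 ?invr_gt0 ?weight_gt0//.
by rewrite normr_le0 => /eqP.
Qed.

HB.instance Definition _ := Lmodule_isNormed.Build R (C0R s)
  C0R_normD C0R_normZ C0R_norm0_eq0.

End C0R_normed.

Section weak_star.
Context {R : realType} (V : normedModType R).

Definition dual : Type := {L : {linear V -> R^o} | continuous L}.

HB.instance Definition _ := gen_eqMixin dual.
HB.instance Definition _ := gen_choiceMixin dual.

Definition dual_eval (L : dual) : {ptws V -> R^o} := fun v => sval L v.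

(* Coarsest topology on the dual making all evaluations continuous. *)
Definition weak_star : Type := initial_topology dual_eval.

End weak_star.

Section problem.
Context {R : realType}.
Notation prob := (probability (measurableTypeR R) R).
Implicit Types (m r : prob) (S : set prob) (p q : \bar R).

(* The image of [S] in the dual of C_q^0(R): for [r] in [Pset q], integration
   against [r] is a continuous linear functional, so it is one of the [L]. *)
Definition as_functionals q S : set (weak_star (C0R q)) :=
  [set L | exists2 r, S r &
     forall g : C0R q, dual_eval L g = \int[r]_x g x].

Definition weak_star_closed q S : Prop :=
  closed (as_functionals S : set (weak_star (C0R q))).

Definition support_union S : set R := \bigcup_(r in S) supp r.

Definition sigma S (g : R -> R) : \bar R :=
  ereal_sup [set (\int[r]_(y in support_union S) (g y)%:E)%E | r in S].

Definition conj_on (Y : set R) (g : R -> R) (x : R) : \bar R :=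
  ereal_sup [set (x * y - g y)%:E | y in Y].

Definition K p q m S : set ((R -> R) * (R -> R)) :=
  [set fg | [/\ C0 p (supp m) fg.1, C0 q (support_union S) fg.2 &
     forall x y, supp m x -> support_union S y -> x * y <= fg.1 x + fg.2 y]].

Definition J m S (fg : (R -> R) * (R -> R)) : \bar R :=
  (\int[m]_(x in supp m) (fg.1 x)%:E + sigma S fg.2)%E.

Definition Jtilde m S (g : R -> R) : \bar R :=
  (\int[m]_(x in supp m) conj_on (support_union S) g x + sigma S g)%E.

End problem.

(* Main.v *)
Require Import Defs.
From mathcomp Require Import all_boot all_order all_algebra.
From mathcomp Require Import all_classical all_reals all_analysis.
From mathcomp Require Import measurable_realfun.
From mathcomp Require Import ring lra.
Import Order.TTheory GRing.Theory Num.Theory.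
Import numFieldNormedType.Exports.
Local Open Scope classical_set_scope.
Local Open Scope ring_scope.

(** Both problems are attained because replacing a pair by conjugates does not
    increase the cost and confines the competitors to a compact set.

    Write X for the support of m and Y for the union of the supports of the
    measures in S. A constraint of K says that f dominates the conjugate of g
    on X and that g dominates the conjugate of f on Y. The cost J is monotone
    in f and in g, so passing from (f, g) to (f1, g1), with f1 the conjugate of
    g and g1 the conjugate of f1, stays in K and does not increase J. As m and
    the measures in S have mass one, J does not change when a constant moves
    from f to g; hence f1 may also be taken to vanish at 0. Since Y lies in
    some ball of radius B, a conjugate over Y is a supremum of affine maps
    with slopes bounded by B, and so it is B-Lipschitz on the whole line
    ([conjugate_lipschitz]). It remains to minimise h |-> J(h, h^* ) over the
    B-Lipschitz functions vanishing at 0 ([normalised_conjugate]).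

    That family is relatively compact for uniform convergence on compact sets
    by Ascoli's theorem, and the functional is 2-Lipschitz for the uniform norm
    on the compact set X: if h and k are e-close on X, their conjugates are
    e-close on Y. So a cluster point of a minimising sequence is a minimiser
    ([normalised_lipschitz_min]), which gives [dual_attained].

    The second problem reduces to the first: J~(g) = J(g^*, g) is at least the
    minimum of J, and at the second component k of an optimal pair (h, k) it is
    at most J(h, k), because k^* <= h on X.

    Everything about J rests on one estimate, [J_le_shift]: f <= f' + c on X and
    g <= g' + d on Y imply J(f, g) <= J(f', g') + (c + d). One delicate point
    is that Y, an arbitrary union of closed sets, may fail to be measurable,
    while sigma integrates over Y. An integral over a non-measurable domain
    is still a supremum over simple functions, and cutting these down to the
    support of r, which has full mass, does not change their integrals
    ([integral_conull]); so the integral over Y is one over the closed support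
    of r. *)

(** * Integrals over domains containing a measurable set of full measure *)

Section conull.
Context d (T : measurableType d) (R : realType).
Context (mu : {measure set T -> \bar R}).
Import HBNNSimple.

(** [D] need not be measurable, so additivity over [A] and [D] minus [A] is not
    available: the argument works on the simple functions that define the
    integral, by truncating them outside [A]. *)
Lemma ge0_integral_conull (A D : set T) (f : T -> \bar R) :
  measurable A -> A `<=` D -> mu (~` A) = 0%E ->
  (forall x, D x -> (0 <= f x)%E) ->
  (\int[mu]_(x in D) f x = \int[mu]_(x in A) f x)%E.
Proof.
move=> mA AD muA0 f0; have f0A x : A x -> (0 <= f x)%E by move=> /AD; exact: f0.
rewrite !ge0_integralE//; apply/eqP; rewrite eq_le; apply/andP; split.
  apply: ge_ereal_sup => _ [h /= hf <-].
  apply: ereal_sup_ubound; exists (proj_nnsfun h mA).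
    move=> x /=; rewrite -[X in X%:E]/(proj_nnsfun h mA x) -mrestrict.
    rewrite !patchE; case: ifPn => // xA.
    by have := hf x; rewrite patchE ifT// inE; apply/AD/set_mem.
  rewrite -mrestrict -integral_nnsfun// -integralT_nnsfun.
  rewrite [in RHS](@ge0_negligible_integral _ _ _ mu setT (~` A))//=.
  - by rewrite setTD setCK.
  - exact: measurableC.
  - exact/measurable_EFinP.
  - by move=> x _; rewrite lee_fin.
apply: ge_ereal_sup => _ [h /= hf <-]; apply: ereal_sup_ubound; exists h => // x.
apply: (le_trans (hf x)); rewrite !patchE; case: ifPn => xA.
  by rewrite ifT// inE; apply/AD/set_mem.
by case: ifPn => // /set_mem /f0.
Qed.

Lemma integral_conull (A D : set T) (f : T -> \bar R) :
  measurable A -> A `<=` D -> mu (~` A) = 0%E ->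
  (\int[mu]_(x in D) f x = \int[mu]_(x in A) f x)%E.
Proof.
move=> mA AD muA0; rewrite integralE [RHS]integralE.
by congr (_ - _)%E; apply: ge0_integral_conull.
Qed.

End conull.

(** * The support of a probability measure on the line *)

Section support.
Context {R : realType}.
Notation prob := (probability (measurableTypeR R) R).
Implicit Types (r : prob).

Lemma closed_supp r : closed (supp r).
Proof.
rewrite -openC openE => x /existsNP[U] /not_implyP[[oU Ux] rU].
rewrite /interior nbhsE; exists U => // y Uy yr.
exact/rU/yr.
Qed.

Lemma measurable_supp r : measurable (supp r : set (measurableTypeR R)).
Proof. exact: closed_measurable (closed_supp r). Qed.

(** Every point outside the support lies in a null interval with rational
    endpoints, and there are only countably many such intervals. *)
Lemma supp_conull r : r (~` supp r) = 0%E.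
Proof.
have mC : measurable (~` supp r : set (measurableTypeR R)).
  exact: measurableC (measurable_supp r).
apply/(negligibleP _ mC).
pose J (ab : rat * rat) : set R := `]ratr ab.1, ratr ab.2[%classic.
(* Enumerates the null intervals with rational endpoints. *)
pose F n : set (measurableTypeR R) :=
  if unpickle n is Some ab
  then if r (J ab) == 0%E then J ab else set0 else set0.
apply: (@negligibleS _ _ _ _ (\bigcup_n F n)).
  move=> x /existsNP[U] /not_implyP[[oU Ux] rU].
  have /nbhs_ballP[e /= e0 eU] : nbhs x U by apply: open_nbhs_nbhs.
  have [a /andP[xa ax]] : exists a : rat, x - e < ratr a < x.
    have xe : x - e < x by rewrite ltrBlDr ltrDl.
    by have [a] := rat_in_itvoo xe; rewrite in_itv/=; exists a.
  have [b /andP[xb bx]] : exists b : rat, x < ratr b < x + e.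
    have xe : x < x + e by rewrite ltrDl.
    by have [b] := rat_in_itvoo xe; rewrite in_itv/=; exists b.
  exists (pickle (a, b)); [exact: I|rewrite /F pickleK].
  have JU : J (a, b) `<=` U.
    move=> y; rewrite /J /= in_itv/= => /andP[ay yb]; apply: eU.
    rewrite ball_itv /= in_itv/=; apply/andP; split.
      exact: lt_trans ay.
    exact: lt_trans bx.
  rewrite ifT; first by rewrite /J /= in_itv/= ax.
  rewrite -measure_le0; apply: (@le_trans _ _ (r U)).
    apply: le_measure; rewrite ?inE//; first exact: measurable_itv.
    exact: open_measurable.
  by rewrite leNgt; apply/negP.
apply: negligible_bigcup => n; rewrite /F.
case: unpickle => [ab|]; last exact: negligible_set0.
case: ifPn => [/eqP|_]; last exact: negligible_set0.
by move=> h; apply/negligibleP => //; exact: measurable_itv.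
Qed.

Lemma supp_full r : r (supp r) = 1%E.
Proof.
have := probability_setC r (measurableC (measurable_supp r)).
by rewrite setCK supp_conull sube0.
Qed.

Lemma supp_nonempty r : supp r !=set0.
Proof.
apply/set0P/eqP => r0; have := supp_full r; rewrite r0 measure0 => /esym/eqP.
by rewrite onee_eq0.
Qed.

(** On a bounded set this is membership in [C0 s] for every exponent [s >= 0];
    see [C0_bounded_continuous] and [bounded_continuous_C0]. *)
Definition bounded_continuous (D : set R) (f : R -> R) :=
  {within D, continuous f} /\ exists M, forall x, D x -> `|f x| <= M.

(** Monotonicity and invariance under constants in one inequality; the constant
    passes through because the support of [r] has mass one. *)
Lemma le_integral_shift r (D : set R) (f g : R -> R) (c : R) :
  supp r `<=` D -> bounded_continuous D f -> bounded_continuous D g ->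
  (forall x, D x -> f x <= g x + c) ->
  (\int[r]_(x in D) (f x)%:E <= \int[r]_(x in D) (g x)%:E + c%:E)%E.
Proof.
move=> rD fD gD fg.
rewrite !(integral_conull _ _ _ r _ _ _ (measurable_supp r) rD (supp_conull r)).
have int h : bounded_continuous D h -> r.-integrable (supp r) (EFin \o h).
  move=> [ch [M hM]]; apply: measurable_bounded_integrable.
  - exact: measurable_supp.
  - by have := supp_full r => /= ->; rewrite ltry.
  - apply: subspace_continuous_measurable_fun; first exact: measurable_supp.
    exact: continuous_subspaceW ch.
  - exists M; split; first exact: num_real.
    by move=> N MN x rx; apply: le_trans (ltW MN); exact/hM/rD.
have intc : r.-integrable (supp r) (EFin \o cst c).
  by apply: int; split; [move=> x; exact: cvg_cst|exists `|c|].
rewrite [leRHS](_ : _ = \int[r]_(x in supp r) ((g x)%:E + (cst c x)%:E)%E)%E.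
  apply: le_integral => //.
  - exact: measurable_supp.
  - exact: int.
  - by apply: integrableD => //; [exact: measurable_supp|exact: int].
  - by move=> x /set_mem rx; rewrite -EFinD lee_fin; apply/fg/rD.
rewrite integralD//; [|exact: measurable_supp|exact: int].
congr (_ + _)%E; have /= -> := integral_cst r (measurable_supp r) c%:E.
by have /= -> := supp_full r; rewrite mule1.
Qed.

End support.

(** * Minimisation over normalised Lipschitz functions *)

Section lipschitz.
Context {R : realType}.

Definition lipschitz_with (B : R) (f : R -> R) :=
  forall x y, `|f x - f y| <= B * `|x - y|.

Definition normalised_lipschitz (B : R) : set (R -> R) :=
  [set h | h 0 = 0 /\ lipschitz_with B h].

Lemma lipschitz_with_near (B : R) (x e : R) : 0 < e ->
  \forall y \near x, B * `|x - y| < e.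
Proof.
move=> e0; have B0 : 0 < `|B| + 1 by rewrite ltr_wpDl.
near=> y; apply: (@le_lt_trans _ _ ((`|B| + 1) * `|x - y|)).
  by rewrite ler_wpM2r// (le_trans (ler_norm _))// lerDl.
rewrite mulrC -ltr_pdivlMr//.
near: y; apply: cvgr_dist_lt => //; last by rewrite divr_gt0.
Unshelve. all: by end_near. Qed.

Lemma lipschitz_with_continuous (B : R) f : lipschitz_with B f -> continuous f.
Proof.
move=> lf x; apply/cvgrPdist_lt => e e0; near=> y.
apply: le_lt_trans (lf _ _) _; near: y; exact: lipschitz_with_near.
Unshelve. all: by end_near. Qed.

(** Ascoli: normalisation at 0 bounds the values at [x] by [B * `|x|], and the
    common Lipschitz constant gives equicontinuity. *)
Lemma precompact_normalised_lipschitz (B : R) :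
  precompact (normalised_lipschitz B : set {family compact, R -> R}).
Proof.
apply: pointwise_precompact_equicontinuous.
- exact: Rhausdorff.
- move=> x; apply: (@precompact_subset _ _ `[- (B * `|x|), B * `|x|]).
    move=> _ [h [h0 lh] <-] /=; rewrite in_itv/= -ler_norml.
    by have := lh x 0; rewrite h0 !subr0.
  by apply: compact_precompact; [exact: Rhausdorff|exact: segment_compact].
- move=> x E; rewrite -entourage_ballE => -[e /= e0 eE].
  near=> y => h [_ lh]; apply: eE => /=; rewrite /ball/=.
  by apply: le_lt_trans (lh _ _) _; near: y; exact: lipschitz_with_near.
Unshelve. all: by end_near. Qed.

(** A minimising sequence has a cluster point for uniform convergence on compact
    sets. Closeness on one- and two-point sets shows that the cluster point is
    still normalised and [B]-Lipschitz; closeness on [K] bounds its value. *)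
Lemma normalised_lipschitz_min (B : R) (K : set R) (Phi : (R -> R) -> R) :
  compact K ->
  (forall (h k : R -> R) (e : R),
     normalised_lipschitz B h -> normalised_lipschitz B k ->
     (forall x, K x -> `|h x - k x| <= e) -> Phi h <= Phi k + (e + e)) ->
  0 <= B ->
  exists2 h, normalised_lipschitz B h &
    forall k, normalised_lipschitz B k -> Phi h <= Phi k.
Proof.
move=> cK lPhi B0.
set W := normalised_lipschitz B.
have W0 : W (fun=> 0) by split => // x y; rewrite subrr normr0 mulr_ge0.
have KB : exists M : R, forall x, K x -> `|x| <= M.
  have [M [_ KM]] := compact_bounded cK.
  by exists (M + 1) => x Kx; apply: KM => //; rewrite ltrDl.
have [M KM] := KB.
have lb : has_inf (Phi @` W).
  split; first by exists (Phi (fun=> 0)), (fun=> 0).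
  exists (Phi (fun=> 0) - (B * M + B * M)) => _ [h Wh <-].
  rewrite lerBlDr; apply: lPhi => // x Kx; rewrite sub0r normrN.
  have := Wh.2 x 0; rewrite Wh.1 !subr0 => /le_trans; apply.
  by rewrite ler_wpM2l// KM.
set v := inf (Phi @` W).
have /choice[h hP] : forall n : nat, exists h, W h /\ Phi h < v + n.+1%:R^-1.
  move=> n; have n0 : 0 < n.+1%:R^-1 :> R by rewrite invr_gt0.
  by have [_ [h Wh <-] ?] := inf_adherent n0 lb; exists h.
have := precompact_normalised_lipschitz B; rewrite precompactE => cW.
have [] := cW (h @ \oo) _.
  exists 0%N => // n _; apply: subset_closure; exact: (hP n).1.
move=> h0 [_ clh].
have close (C : set R) (e : R) N : compact C -> 0 < e ->
    exists2 n, (N <= n)%N & forall x, C x -> `|h0 x - h n x| < e.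
  move=> cC e0.
  have := clh [set g | exists2 n, (N <= n)%N & g = h n]
    [set g | forall x, C x -> ball (h0 x) e (g x)].
  case.
  - by exists N => // n /= Nn; exists n.
  - exact: (@fam_nbhs R R compact C [set xy | ball xy.1 e xy.2] h0
      (entourage_ball _ (PosNum e0))).
  - by move=> _ [[n Nn ->] /= hn]; exists n.
have Wh0 : W h0.
  split.
    apply/eqP; rewrite -normr_le0; apply/ler_addgt0Pr => e e0; rewrite add0r.
    have [n _ /(_ 0 erefl)] := close [set 0] e 0%N (@compact_set1 _ _) e0.
    by rewrite (hP n).1.1 subr0 => /ltW.
  move=> x y; apply/ler_addgt0Pr => e e0.
  have e20 : 0 < e / 2 by rewrite divr_gt0.
  have cxy : compact ([set x] `|` [set y] : set R).
    by apply: compactU; exact: compact_set1.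
  have [n _ hn] := close _ (e / 2) 0%N cxy e20.
  have hx := hn x (or_introl erefl).
  have hy := hn y (or_intror erefl).
  have := (hP n).1.2 x y.
  move: hx hy; rewrite !ltr_norml !ler_norml => /andP[? ?] /andP[? ?] /andP[? ?].
  apply/andP; split; lra.
exists h0 => // k Wk.
apply: (@le_trans _ _ v); last by apply: inf_lbound; [exact: lb.2|exists k].
apply/ler_addgt0Pr => e e0.
(* One third for the distance of [Phi (h n)] to the infimum, two thirds for
   replacing [h n] by [h0]. *)
have e30 : 0 < e / 3 by rewrite divr_gt0.
have [N _ /(_ _ (leqnn N)) HN] := near_infty_natSinv_lt (PosNum e30).
have [n Nn hn] := close K (e / 3) N cK e30.
have := lPhi h0 (h n) (e / 3) Wh0 (hP n).1 (fun x Kx => ltW (hn x Kx)).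
have := (hP n).2.
have : n.+1%:R^-1 <= N.+1%:R^-1 :> R by rewrite lef_pV2 ?posrE// ler_nat ltnS.
move: HN => /= HN nN hnv h0hn.
suff arith (a b c d w t : R) : d <= c -> b < w + d -> a <= b + (t / 3 + t / 3) ->
    c < t / 3 -> a <= w + t by exact: arith nN hnv h0hn HN.
by lra.
Qed.

End lipschitz.

(** * Weighted continuous functions on bounded sets *)

Section bounded.
Context {R : realType}.
Implicit Types (s p q : \bar R) (Z : set R) (f g : R -> R).

Lemma bounded_set_radius Z : bounded_set Z ->
  exists2 B : R, 0 <= B & forall x, Z x -> `|x| <= B.
Proof.
move=> [M [_ ZM]]; exists (`|M| + 1); first by rewrite addr_ge0.
by move=> x Zx; apply: ZM => //; rewrite ltr_pwDr// ler_norm.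
Qed.

Lemma C0_bounded_continuous s Z f : (0 <= s)%E -> bounded_set Z ->
  C0 s Z f -> bounded_continuous Z f.
Proof.
move=> s0 /bounded_set_radius[B B0 ZB] [cf fy]; split => //.
have [N fN] : exists N : R, (wnorm s Z f <= N%:E)%E.
  case E : (wnorm s Z f) fy => [N| |] fy; [by exists N|by rewrite ltxx in fy|].
  by exists 0; rewrite leNye.
have weight_le x : Z x -> weight s x <= 1 + B `^ fine s.
  move=> Zx; case: s s0 {fy fN} => [t||] //= t0.
    by rewrite lerD2l ge0_ler_powR// ?nnegrE//; exact: ZB.
  by rewrite lerDl powR_ge0.
exists (`|N| * (1 + B `^ fine s)) => x Zx.
have : ((`|f x| / weight s x)%:E <= N%:E)%E.
  by apply: le_trans fN; apply: ereal_sup_ubound; exists x.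
rewrite lee_fin ler_pdivrMr ?weight_gt0// => /le_trans; apply.
apply: (@le_trans _ _ (`|N| * weight s x)).
  by rewrite ler_wpM2r ?ler_norm// ltW// weight_gt0.
by rewrite ler_wpM2l// weight_le.
Qed.

Lemma bounded_continuous_C0 s Z f : bounded_continuous Z f -> C0 s Z f.
Proof.
move=> [cf [M fM]]; split => //; apply: (@le_lt_trans _ _ M%:E); last exact: ltry.
apply: ge_ereal_sup => _ [x Zx <-]; rewrite lee_fin ler_pdivrMr ?weight_gt0//.
have w1 : 1 <= weight s x by case: s => //= t; rewrite lerDl powR_ge0.
have M0 : 0 <= M by apply: le_trans (fM _ Zx).
by apply: le_trans (fM _ Zx) _; rewrite ler_peMr.
Qed.

Lemma bounded_continuous_cst Z (c : R) : bounded_continuous Z (fun=> c).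
Proof. by split; [move=> x; exact: cvg_cst|exists `|c|]. Qed.

Lemma lipschitz_bounded_continuous (B : R) Z f : 0 <= B -> bounded_set Z ->
  lipschitz_with B f -> bounded_continuous Z f.
Proof.
move=> B0 /bounded_set_radius[C C0 ZC] lf; split.
  by apply: continuous_subspaceT; exact: lipschitz_with_continuous lf.
exists (`|f 0| + B * C) => x Zx; rewrite -[f x](subrK (f 0)) addrC.
apply: le_trans (ler_normD _ _) _; rewrite lerD2l.
by apply: le_trans (lf _ _) _; rewrite subr0 ler_wpM2l// ZC.
Qed.

Lemma conjugate_exponent_ge0 p q :
  (1 <= p)%E -> (p^-1 + q^-1 = 1)%E -> (0 <= q)%E.
Proof.
move=> p1 pq; rewrite -inve_ge0 leNgt; apply/negP => q0.
have {}p1 : (p^-1 <= 1)%E.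
  case: p p1 {pq} => [r||] //; rewrite ?invey ?lee_fin// => r1.
  by rewrite inver gt_eqF ?(lt_le_trans _ r1)// lee_fin invf_le1// (lt_le_trans _ r1).
suff : (p^-1 + q^-1 < 1)%E by rewrite pq ltxx.
apply: (@le_lt_trans _ _ (1 + q^-1)%E); first exact: leeD2r.
case: (q^-1)%E q0 => [r| |] //; last by move=> _; exact: ltNyr.
by rewrite -EFinD !lte_fin gtrDl.
Qed.

End bounded.

(** * Conjugates over a bounded set *)

Section conjugate.
Context {R : realType}.
Context (D : set R) (B : R) (g : R -> R).
Context (D0 : D !=set0) (DB : forall y, D y -> `|y| <= B).
Context (gD : bounded_continuous D g).

(** Real-valued and taken on the whole line, so that it can be normalised at 0,
    a point that need not lie in any support. *)
Definition conjugate (x : R) : R := sup [set x * y - g y | y in D].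

Lemma conjugate_has_sup x : has_sup [set x * y - g y | y in D].
Proof.
have [y Dy] := D0; have [M gM] := gD.2.
split; first by exists (x * y - g y), y.
exists (`|x| * B + M) => _ [z Dz <-]; apply: lerD.
  by apply: le_trans (ler_norm _) _; rewrite normrM ler_wpM2l// DB.
by apply: le_trans (ler_norm _) _; rewrite normrN gM.
Qed.

Lemma conj_onE x : conj_on D g x = (conjugate x)%:E.
Proof.
have [D1 Dub] := conjugate_has_sup x; rewrite /conjugate -ereal_sup_EFin//.
by rewrite image_comp.
Qed.

Lemma le_conjugate x y : D y -> x * y - g y <= conjugate x.
Proof.
by move=> Dy; apply: ub_le_sup; [exact: (conjugate_has_sup x).2|exists y].
Qed.

Lemma conjugate_le x u : (forall y, D y -> x * y - g y <= u) -> conjugate x <= u.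
Proof.
move=> gu; apply: ge_sup; first exact: (conjugate_has_sup x).1.
by move=> _ [y Dy <-]; exact: gu.
Qed.

Lemma conjugate_lipschitz : lipschitz_with B conjugate.
Proof.
have half x x' : conjugate x <= conjugate x' + B * `|x - x'|.
  apply: conjugate_le => y Dy.
  have -> : x * y - g y = x' * y - g y + y * (x - x') by ring.
  apply: lerD; first exact: le_conjugate.
  by apply: le_trans (ler_norm _) _; rewrite normrM ler_wpM2r// DB.
move=> x x'; rewrite ler_norml; apply/andP; split; last by rewrite lerBlDl.
by rewrite lerNl opprB lerBlDl distrC.
Qed.

End conjugate.

(** * Existence of an optimal pair *)

Section duality.
Context {R : realType}.
Context (m : probability (measurableTypeR R) R).
Context (S : set (probability (measurableTypeR R) R)).
Context (bX : bounded_set (supp m)) (S0 : S !=set0).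
Context (bY : bounded_set (support_union S)).
Implicit Types (f g h : R -> R).
Let X := supp m.
Let Y := support_union S.

Lemma support_union_nonempty : Y !=set0.
Proof.
by have [r Sr] := S0; have [y ry] := supp_nonempty r; exists y, r.
Qed.

Lemma sigma_le_shift f g (c : R) :
  bounded_continuous Y f -> bounded_continuous Y g ->
  (forall y, Y y -> f y <= g y + c) -> (sigma S f <= sigma S g + c%:E)%E.
Proof.
move=> fY gY fg; apply: ge_ereal_sup => _ [r Sr <-].
apply: (@le_trans _ _ (\int[r]_(y in Y) (g y)%:E + c%:E)%E).
  by apply: le_integral_shift => // y ry; exists r.
by apply: leeD2r; apply: ereal_sup_ubound; exists r.
Qed.

Lemma J_le_shift f g f' g' (c d : R) :
  bounded_continuous X f -> bounded_continuous X f' ->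
  bounded_continuous Y g -> bounded_continuous Y g' ->
  (forall x, X x -> f x <= f' x + c) -> (forall y, Y y -> g y <= g' y + d) ->
  (J m S (f, g) <= J m S (f', g') + (c + d)%:E)%E.
Proof.
move=> fX f'X gY g'Y ff' gg'; rewrite /J /= EFinD addeACA.
by apply: leeD; [exact: le_integral_shift|exact: sigma_le_shift].
Qed.

(** Comparison of [(f, g)] with the pair of zero functions, of cost 0. *)
Lemma J_fin_num f g : bounded_continuous X f -> bounded_continuous Y g ->
  J m S (f, g) \is a fin_num.
Proof.
move=> fX gY; have [[_ [M fM]] [_ [N gN]]] := (fX, gY).
have J0 : J m S (fun=> 0, fun=> 0) = 0%E.
  rewrite /J /= integral0 add0e /sigma.
  under eq_imagel do rewrite integral0.
  have [r Sr] := S0.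
  rewrite (_ : [set _ | _ in S] = [set 0%E]) ?ereal_sup1//.
  by apply/seteqP; split => [_ [? _ <-]//|_ ->]; exists r.
have z Z : bounded_continuous Z (fun=> 0 : R) by exact: bounded_continuous_cst.
have up : (J m S (f, g) <= (M + N)%:E)%E.
  rewrite -[leRHS]add0e -J0; apply: J_le_shift => // [x Xx|y Yy]; rewrite add0r.
    exact: le_trans (ler_norm _) (fM _ Xx).
  exact: le_trans (ler_norm _) (gN _ Yy).
have low : (0 <= J m S (f, g) + (M + N)%:E)%E.
  rewrite -J0; apply: J_le_shift => // [x Xx|y Yy]; rewrite -lerBlDl sub0r lerNl.
    by have := fM _ Xx; rewrite ler_norml => /andP[].
  by have := gN _ Yy; rewrite ler_norml => /andP[].
by case: (J m S (f, g)) up low.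
Qed.

Lemma common_radius : exists B, [/\ 0 <= B, forall x, X x -> `|x| <= B &
  forall y, Y y -> `|y| <= B].
Proof.
have [B B0 XB] := bounded_set_radius _ bX.
have [C C0 YC] := bounded_set_radius _ bY.
exists (B + C); split=> [|x Xx|y Yy]; first exact: addr_ge0.
  by apply: le_trans (XB _ Xx) _; rewrite lerDl.
by apply: le_trans (YC _ Yy) _; rewrite lerDr.
Qed.

(** The competitor is the conjugate [f1] of [g], shifted to vanish at 0: the
    constraint gives [f1 <= f] on [X], the conjugate of [f1] is at most [g] on
    [Y], and the two shifts by [f1 0] cancel. *)
Lemma normalised_conjugate f g B : 0 <= B ->
  (forall x, X x -> `|x| <= B) -> (forall y, Y y -> `|y| <= B) ->
  bounded_continuous X f -> bounded_continuous Y g ->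
  (forall x y, X x -> Y y -> x * y <= f x + g y) ->
  exists2 h, normalised_lipschitz B h &
    (J m S (h, conjugate X h) <= J m S (f, g))%E.
Proof.
move=> B0 XB YB fX gY fgK.
have Y0 := support_union_nonempty; have X0 : X !=set0 := supp_nonempty m.
set f1 := conjugate Y g.
have lf1 : lipschitz_with B f1 by exact: conjugate_lipschitz.
pose h x := f1 x - f1 0.
have lh : lipschitz_with B h.
  by move=> x y; rewrite /h opprB addrA subrK.
have hX := lipschitz_bounded_continuous _ _ _ B0 bX lh.
have lk : lipschitz_with B (conjugate X h) by exact: conjugate_lipschitz.
have kY := lipschitz_bounded_continuous _ _ _ B0 bY lk.
exists h; first by split => //; rewrite /h subrr.
rewrite -[leRHS]adde0 -[X in (_ + X)%E]/((0 : R)%:E) -(addNr (f1 0)).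
apply: J_le_shift => // [x Xx|y Yy].
  rewrite lerD2r; apply: (conjugate_le _ B) => // y Yy.
  by rewrite lerBlDr; exact: fgK.
apply: (conjugate_le _ B) => // x Xx.
have := le_conjugate _ _ _ Y0 YB gY x y Yy; rewrite -/f1 /h; lra.
Qed.

Lemma dual_attained : exists h, [/\ bounded_continuous X h,
  bounded_continuous Y (conjugate X h),
  (forall x y, X x -> Y y -> x * y <= h x + conjugate X h y) &
  forall f g, bounded_continuous X f -> bounded_continuous Y g ->
    (forall x y, X x -> Y y -> x * y <= f x + g y) ->
    (J m S (h, conjugate X h) <= J m S (f, g))%E].
Proof.
have [B [B0 XB YB]] := common_radius.
have X0 : X !=set0 := supp_nonempty m.
have WX h : normalised_lipschitz B h -> bounded_continuous X h.
  by move=> [_]; exact: lipschitz_bounded_continuous.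
have Wl h : normalised_lipschitz B h -> lipschitz_with B (conjugate X h).
  by move=> /WX hX; exact: conjugate_lipschitz.
have WY h : normalised_lipschitz B h -> bounded_continuous Y (conjugate X h).
  by move=> /Wl; exact: lipschitz_bounded_continuous.
have Jfin h : normalised_lipschitz B h -> J m S (h, conjugate X h) \is a fin_num.
  by move=> Wh; apply: J_fin_num; [exact: WX|exact: WY].
have cX : compact X.
  apply: (subclosed_compact (closed_supp m) (@segment_compact R (- B) B)).
  by move=> x /XB; rewrite /= in_itv/= -ler_norml.
have [] := normalised_lipschitz_min B X
  (fun h => fine (J m S (h, conjugate X h))) cX _ B0.
  move=> h k e Wh Wk hk; rewrite -lee_fin EFinD !fineK; [|exact: Jfin..].
  have hke x : X x -> h x <= k x + e /\ k x <= h x + e.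
    move=> /hk; rewrite ler_norml => /andP[? ?]; split; lra.
  apply: J_le_shift; [exact: WX|exact: WX|exact: WY|exact: WY| |].
    by move=> x /hke[].
  move=> y Yy; apply: (conjugate_le _ B) => //; first exact: WX.
  move=> x Xx; have := le_conjugate _ _ _ X0 XB (WX _ Wk) y x Xx.
  have [] := hke _ Xx; lra.
move=> h Wh hmin; exists h; split; [exact: WX|exact: WY| |].
  move=> x y Xx Yy; rewrite -lerBlDl mulrC; apply: (le_conjugate _ B) => //.
  exact: WX.
move=> f g fX gY fgK.
have [k Wk] := normalised_conjugate _ _ _ B0 XB YB fX gY fgK.
apply: le_trans; rewrite -(fineK (Jfin _ Wh)) -(fineK (Jfin _ Wk)) lee_fin.
exact: hmin.
Qed.

Lemma JtildeE g : bounded_continuous Y g ->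
  Jtilde m S g = J m S (conjugate Y g, g).
Proof.
have [B [_ _ YB]] := common_radius; move=> gY.
rewrite /Jtilde /J /=; congr (_ + _)%E; apply: eq_integral => x _.
by rewrite (conj_onE _ B)//; exact: support_union_nonempty.
Qed.

End duality.

Theorem theorem5p6 (R : realType) (p q : \bar R)
    (hp : (1 <= p)%E) (hpq : (p^-1 + q^-1 = 1)%E)
    (m : probability (measurableTypeR R) R)
    (hm : Pset p m) (hX : bounded_set (supp m))
    (S : set (probability (measurableTypeR R) R))
    (hSP : S `<=` Pset q) (hS0 : S !=set0)
    (hSb : (ereal_sup [set moment q r | r in S] < +oo)%E)
    (hSconv : convex_family S) (hScl : weak_star_closed q S)
    (hY : bounded_set (support_union S)) :
  (exists2 fg, K p q m S fg & J m S fg = ereal_inf (J m S @` K p q m S)) /\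
  (exists2 g, C0 q (support_union S) g &
     Jtilde m S g = ereal_inf (Jtilde m S @` C0 q (support_union S))).

Proof.
have q0 := conjugate_exponent_ge0 _ _ hp hpq.
have p0 : (0 <= p)%E by apply: le_trans hp.
have [h [hfX kY hk hmin]] := dual_attained m S hX hS0 hY.
set X := supp m in hfX hk hmin *; set Y := support_union S in kY hk hmin *.
set k := conjugate X h in kY hk hmin.
have conjK g : bounded_continuous Y g -> bounded_continuous X (conjugate Y g) /\
    forall x y, X x -> Y y -> x * y <= conjugate Y g x + g y.
  move=> gY; have [B [B0 XB YB]] := common_radius m S hX hY.
  have Y0 : Y !=set0 by exact: support_union_nonempty.
  split.
    by apply: (lipschitz_bounded_continuous B) => //; exact: conjugate_lipschitz.
  by move=> x y _ Yy; rewrite -lerBlDr; apply: (le_conjugate _ B).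
have Jt g : bounded_continuous Y g -> (J m S (h, k) <= Jtilde m S g)%E.
  by move=> gY; rewrite JtildeE//; have [cY cK] := conjK _ gY; exact: hmin.
split.
  have Khk : K p q m S (h, k) by split => //; exact: bounded_continuous_C0.
  exists (h, k) => //; apply/eqP; rewrite eq_le; apply/andP; split; last first.
    by apply: ereal_inf_lbound; exists (h, k).
  apply: le_ereal_inf_tmp => _ [[f g] [/= fX gY fgK] <-].
  apply: hmin => //; first exact: (C0_bounded_continuous p).
  exact: (C0_bounded_continuous q).
have Jk : (Jtilde m S k <= J m S (h, k))%E.
  rewrite JtildeE// -[leRHS]adde0 -[X in (_ + X)%E]/((0 : R)%:E) -(addr0 0).
  have [cY cK] := conjK _ kY.
  have [B [B0 XB YB]] := common_radius m S hX hY.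
  apply: J_le_shift => // [x Xx|y Yy]; rewrite addr0//.
  apply: (conjugate_le _ B) => //; first exact: support_union_nonempty.
  by move=> y Yy; rewrite lerBlDr; exact: hk.
exists k; first exact: bounded_continuous_C0.
apply/eqP; rewrite eq_le; apply/andP; split.
  apply: le_ereal_inf_tmp => _ [g gY <-]; apply: le_trans Jk (Jt _ _).
  exact: (C0_bounded_continuous q).
by apply: ereal_inf_lbound; exists k => //; exact: bounded_continuous_C0.
Qed.
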